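(* Let $M$ be a countable set and let $G \leq \mathrm{Sym}(M)$ be a primitive permutation group with no algebraicity such that at least one of the following two conditions holds: (i) $G \curvearrowright M$ has uniform non-algebraicity; or (ii) every stabilizer $G_a$, $a \in M$, is a boundedly maximal subgroup of $G$. (If $G$ is Roelcke precompact, then both conditions (i) and (ii) hold automatically under the other hypotheses.) Then any $G$-invariant, ergodic Borel probability measure on $[0,1]^M$ is a product measure.
   Context: $G \leq \mathrm{Sym}(M)$ is equipped with the topology inherited from $\mathrm{Sym}(M)$ (pointwise convergence). A topological group $G$ is Roelcke precompact if for every neighborhood $U$ of $1_G$ there is a finite $F \subseteq G$ with $G = UFU$. $G$ is primitive if it is transitive on $M$ and there are no non-trivial $G$-invariant partitions of $M$ (equivalently, it is transitive and each point stabilizer $G_a$ is a maximal subgroup of $G$). $G_{(A)}$ denotes the pointwise stabilizer of $A \subseteq M$. $G \curvearrowright M$ has no algebraicity if for every finite $A \subseteq M$, all orbits of $G_{(A)}$ on $M \setminus A$ are infinite. Two finite tuples $\bar a,\bar b\in M^n$ have the same type, $\mathrm{tp}\,\bar a=\mathrm{tp}\,\bar b$, if they lie in the same orbit of the diagonal action $G \curvearrowright M^n$; two countably infinite tuples have the same type if all their corresponding finite initial segments do (so for an infinite $\bar b = (b_0,b_1,\dots)$ and $a\in M$, $\mathrm{tp}(\bar b a)=\mathrm{tp}(\bar b' a')$ means that for every $n$, $(b_0,\dots,b_{n-1},a)$ and $(b'_0,\dots,b'_{n-1},a')$ are in the same $G$-orbit). $G \curvearrowright M$ has uniform non-algebraicity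 if for all finite or countably infinite tuples $\bar b$ from $M$ and all $a \in M$ not occurring in $\bar b$, there exist a tuple $\bar b'$ from $M$ and $a' \neq a''$ in $M$ with $\mathrm{tp}(\bar b' a') = \mathrm{tp}(\bar b' a'') = \mathrm{tp}(\bar b a)$. $G_a$ is boundedly maximal in $G$ if there is $d \in \mathbb{N}$ such that for every $g \in G\setminus G_a$, every element of $G$ can be written as a word of length at most $d$ in $g$, $g^{-1}$ and elements of $G_a$. $G$ acts on $[0,1]^M$ by the shift $(g\cdot\omega)(a) = \omega(g^{-1}\cdot a)$. An invariant measure $\mu$ is ergodic if every measurable $E$ with $\mu(g\cdot E \,\triangle\, E)=0$ for all $g \in G$ has measure $0$ or $1$. *)

(* Defs.v *)
From HB Require Import structures.
From mathcomp Require Import all_boot all_order all_algebra.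
From mathcomp Require Import finmap.
From mathcomp Require Import all_classical all_reals all_analysis.

Set Implicit Arguments.
Unset Strict Implicit.
Unset Printing Implicit Defensive.

Import Order.TTheory GRing.Theory Num.Theory.
Import numFieldNormedType.Exports.

Local Open Scope classical_set_scope.

(* Sym(M). The field [sym_inv] is determined by [sym_fun], see [sym_ext]. *)
Record Sym (M : Type) : Type := MkSym {
  sym_fun :> M -> M;
  sym_inv : M -> M;
  sym_funK : cancel sym_fun sym_inv;
  sym_invK : cancel sym_inv sym_fun }.

Lemma sym_ext (M : Type) (g h : Sym M) : sym_fun g =1 sym_fun h -> g = h.
Proof.
case: g h => [f f' fK f'K] [k k' kK k'K] /= /funext fk.
rewrite -{}fk in kK k'K *.
have ff' : f' = k' by apply/funext => x; rewrite -{1}(k'K x) fK.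
by case: _ / ff' in kK k'K *; congr MkSym; exact: Prop_irrelevance.
Qed.

HB.instance Definition _ (M : Type) := gen_eqMixin (Sym M).
HB.instance Definition _ (M : Type) := gen_choiceMixin (Sym M).

Section SymGroup.
Variable M : Type.
Implicit Types g h k : Sym M.

Definition sym_one : Sym M :=
  @MkSym M id id (fun=> erefl) (fun=> erefl).
Definition sym_mul g h : Sym M :=
  MkSym (can_comp (sym_funK g) (sym_funK h))
        (can_comp (sym_invK h) (sym_invK g)).
Definition sym_opp g : Sym M := MkSym (sym_invK g) (sym_funK g).

Lemma sym_mulA : associative sym_mul.
Proof. by move=> g h k; exact: sym_ext. Qed.
Lemma sym_mul1g : left_id sym_one sym_mul.
Proof. by move=> g; exact: sym_ext. Qed.
Lemma sym_mulg1 : right_id sym_one sym_mul.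
Proof. by move=> g; exact: sym_ext. Qed.
Lemma sym_mulVg : left_inverse sym_one sym_opp sym_mul.
Proof. by move=> g; apply: sym_ext => x /=; rewrite sym_funK. Qed.
Lemma sym_mulgV : right_inverse sym_one sym_opp sym_mul.
Proof. by move=> g; apply: sym_ext => x /=; rewrite sym_invK. Qed.

HB.instance Definition _ := isGroup.Build (Sym M)
  sym_mulA sym_mul1g sym_mulg1 sym_mulVg sym_mulgV.
End SymGroup.

(* Pointwise convergence, M being discrete. *)
Definition sym_ptws (M : choiceType) (g : Sym M) :
  {ptws M -> discrete_topology M} := sym_fun g.
HB.instance Definition _ (M : choiceType) :=
  Topological.copy (Sym M) (initial_topology (@sym_ptws M)).

Section PermutationGroups.
Variables (M : countType) (G : set (Sym M)).
Local Open Scope group_scope.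

Definition subgroup := group_closed (mem G).

Definition transitive_group := forall a b : M, exists2 g, G g & g a = b.

Definition invariant_partition (P : set (set M)) :=
  partition P id [set: M] /\ forall g B, G g -> P B -> P (g @` B).

Definition primitive :=
  transitive_group /\
  forall P, invariant_partition P -> P = range set1 \/ P = [set [set: M]].

Definition pointwise_stabilizer (A : set M) : set (Sym M) :=
  [set g | G g /\ forall a, A a -> g a = a].

Definition stabilizer (a : M) : set (Sym M) := [set g | G g /\ g a = a].

Definition group_orbit (H : set (Sym M)) (a : M) : set M := [set g a | g in H].

Definition no_algebraicity := forall A : set M, finite_set A ->
  forall a, ~ A a -> infinite_set (group_orbit (pointwise_stabilizer A) a).

Definition same_type (s t : seq M) := exists2 g, G g & map g s = t.

Definition same_type_inf (b : nat -> M) (a : M) (b' : nat -> M) (a' : M) :=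
  forall n, same_type (rcons (mkseq b n) a) (rcons (mkseq b' n) a').

Definition uniform_non_algebraicity :=
  (forall (b : seq M) (a : M), a \notin b ->
     exists (b' : seq M) (a' a'' : M), [/\ a' <> a'',
       same_type (rcons b' a') (rcons b' a'') &
       same_type (rcons b' a'') (rcons b a)]) /\
  (forall (b : nat -> M) (a : M), (forall n, b n <> a) ->
     exists (b' : nat -> M) (a' a'' : M), [/\ a' <> a'',
       same_type_inf b' a' b' a'' &
       same_type_inf b' a'' b a]).

(* [H] is meant to be a subgroup of [G]. *)
Definition boundedly_maximal (H : set (Sym M)) :=
  exists d : nat, forall g, (G `\` H) g -> forall h, G h ->
    exists w : seq (Sym M), [/\ (size w <= d)%N,
      forall x, x \in w -> [\/ x = g, x = g^-1 | H x] &
      h = \prod_(x <- w) x].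

(* [U `<=` G] and [within G] make [U] a neighborhood of 1 in the subspace G. *)
Definition roelcke_precompact :=
  forall U : set (Sym M), U `<=` G -> within G (nbhs (1 : Sym M)) U ->
    exists F : set (Sym M), [/\ finite_set F, F `<=` G &
      G = [set x * y | x in [set u * f | u in U & f in F] & y in U]].

End PermutationGroups.

Definition unit_interval (R : realType) : Type := set_type (`[0%R, 1%R] : set R).

HB.instance Definition _ (R : realType) := Choice.on (unit_interval R).
HB.instance Definition _ (R : realType) := Topological.on (unit_interval R).

Lemma zero_in_unit_interval (R : realType) :
  0%R \in (`[0%R, 1%R] : set R).
Proof. by rewrite inE /= in_itv /= lexx ler01. Qed.

HB.instance Definition _ (R : realType) :=
  isPointed.Build (unit_interval R) (exist _ 0%R (zero_in_unit_interval R)).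

Definition cube (R : realType) (M : Type) := {ptws M -> unit_interval R}.
HB.instance Definition _ (R : realType) (M : Type) := Topological.on (cube R M).
HB.instance Definition _ (R : realType) (M : Type) :=
  isPointed.Build (cube R M) (fun=> point).

Notation borel T := (g_sigma_algebraType (@open T)).

Section InvariantMeasures.
Variables (R : realType) (M : countType).
Variables (G : set (Sym M)) (mu : probability (borel (cube R M)) R).

Definition cube_shift (g : Sym M) (w : cube R M) : cube R M :=
  fun a => w ((g^-1)%g a).

Definition invariant_measure :=
  forall g, G g -> forall E : set (borel (cube R M)), measurable E ->
    mu (cube_shift g @` E) = mu E.

Definition ergodic :=
  forall E : set (borel (cube R M)), measurable E ->
    (forall g, G g -> mu ((cube_shift g @` E) `+` E) = 0%E) ->
    mu E = 0%E \/ mu E = 1%E.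

(* mu is the product of the nu a: these values on cylinders determine it. *)
Definition product_measure :=
  exists nu : M -> probability (borel (unit_interval R)) R,
  forall (A : {fset M}) (B : M -> set (borel (unit_interval R))),
    (forall a, measurable (B a)) ->
    mu [set w | forall a, a \in A -> B a (w a)] =
      (\prod_(a <- A) nu a (B a))%E.

End InvariantMeasures.

(* Main.v *)
(* Fix a Borel set B and let xi_a be the indicator of w a \in B.  Independence
   of the coordinates amounts to zeta_a := E[xi_a | coordinates other than a]
   being constant.  By ergodicity it is enough that zeta_a does not depend on
   a, and by primitivity that zeta_a = zeta_b for a single pair a <> b.
   - Under (i), apply uniform non-algebraicity to an enumeration b of M \ {a}:
     a function of finitely many coordinates approximating zeta_a is transported
     to a function of coordinates in b' that approximates both zeta_a' and
     zeta_a'', because b'a', b'a'' and ba have the same type.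
   - Under (ii), zeta_a is approximated in L^2 by functions of the coordinates
     in some finite A not containing a; such a function is fixed by G_(A), which
     moves a by no algebraicity, and is nearly fixed by G_a.  Every h in G is a
     word of bounded length in these elements, so zeta_a is nearly fixed by h.
   Conditional expectations are replaced by near minimizers of the L^2 distance
   from xi_a to the bounded functions of finitely many coordinates other than
   a; the parallelogram identity makes near minimizers unique up to a small
   error, and a pointwise limit is taken only once, to apply ergodicity.
   If G is Roelcke precompact, G_(A) has finitely many orbits on M for finite A,
   which yields (i) by compactness of the space of types, and G_a has finitely
   many double cosets, which bounds the word lengths in (ii). *)

From HB Require Import structures.
Require Import Defs.
From mathcomp Require Import all_boot all_order all_algebra.
From mathcomp Require Import finmap lra ring.
From mathcomp Require Import all_classical all_reals all_analysis.
From mathcomp Require Import measurable_realfun.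

Set Implicit Arguments.
Unset Strict Implicit.
Unset Printing Implicit Defensive.

Import Order.TTheory GRing.Theory Num.Theory.
Import numFieldNormedType.Exports.

Local Open Scope classical_set_scope.

(** * Primitivity, word lengths and maximality of point stabilizers *)

Section PermutationGroupTheory.
Variables (M : countType) (G : set (Sym M)).
Hypotheses (HG : subgroup G) (Gprim : primitive G).
Implicit Types (a b c : M) (g h k : Sym M).
Local Open Scope group_scope.

Lemma subgroup1 : G 1.
Proof. by have := HG.1; rewrite inE. Qed.

Lemma subgroupV g : G g -> G g^-1.
Proof. by move=> Gg; have := group_closedV HG (mem_set Gg); rewrite inE. Qed.

Lemma subgroupM g h : G g -> G h -> G (g * h).
Proof.
move=> Gg Gh; have := group_closedM HG (mem_set Gg) (mem_set Gh).
by rewrite inE.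
Qed.

(** The classes of [E] form an invariant partition, and a related pair of distinct points excludes
    the partition into singletons. *)
Lemma primitive_equivalence (E : M -> M -> Prop) :
  (forall a, E a a) -> (forall a b, E a b -> E b a) ->
  (forall a b c, E a b -> E b c -> E a c) ->
  (forall g a b, G g -> E a b -> E (g a) (g b)) ->
  forall a b, a <> b -> E a b -> forall c d, E c d.
Proof.
move=> Er Es Et EG a b ab Eab.
pose P : set (set M) := range (fun a => E a).
have Ecls a' b' : E a' b' -> E a' = E b'.
  move=> h; apply/funext => c; apply/propext; split; last exact: Et.
  by apply: Et; exact: Es.
have [|Ps|PT] := Gprim.2 P.
- split; first split.
  + rewrite eqEsubset; split=> // c _; exists (E c); last exact: Er.
    by exists c.
  + move=> _ _ [c _ <-] [d _ <-] [x [/= Ecx Edx]].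
    by rewrite (Ecls _ _ Ecx) (Ecls _ _ Edx).
  + by move=> _ [c _ <-]; exists c; exact: Er.
  + move=> g _ Gg [c _ <-]; exists (g c) => //; apply/funext => d.
    apply/propext; split=> [Egcd|[x Ecx <-]]; last exact: EG.
    exists (g^-1 d); last exact: sym_invK.
    by have := EG _ _ _ (subgroupV Gg) Egcd; rewrite /= sym_funK.
- have : P (E a) by exists a.
  rewrite Ps => -[c _ cE].
  have : E a a by exact: Er.
  by move: Eab; rewrite -cE /= => bc ac; case: ab; rewrite bc ac.
- move=> c d; have : P (E c) by exists c.
  by rewrite PT => /= ->.
Qed.

(** Same formula as inside [boundedly_maximal], so that its instances convert to [word]. *)
Definition word (H : set (Sym M)) (g : Sym M) (n : nat) (h : Sym M) :=
  exists w : seq (Sym M), [/\ (size w <= n)%N,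
    forall x, x \in w -> [\/ x = g, x = g^-1 | H x] &
    h = \prod_(x <- w) x].

Lemma word0 H g : word H g 0 1.
Proof. by exists [::]; split=> //; rewrite big_nil. Qed.

Lemma word1 (H : set (Sym M)) g x :
  [\/ x = g, x = g^-1 | H x] -> word H g 1 x.
Proof.
by exists [:: x]; split=> [//|y|]; rewrite ?big_seq1// mem_seq1 => /eqP->.
Qed.

Lemma wordM H g m n h k : word H g m h -> word H g n k ->
  word H g (m + n) (h * k).
Proof.
move=> [v [sv vP ->]] [w [sw wP ->]]; exists (v ++ w); split.
- by rewrite size_cat leq_add.
- by move=> x; rewrite mem_cat => /orP[/vP|/wP].
- by rewrite big_cat.
Qed.

Lemma wordW H g m n h : (m <= n)%N -> word H g m h -> word H g n h.
Proof.
by move=> mn [w [sw wP ->]]; exists w; split=> //; exact: leq_trans mn.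
Qed.

Lemma word_ind H g (Q : nat -> Sym M -> Prop) :
  Q 0%N 1 -> (forall n x h, [\/ x = g, x = g^-1 | H x] -> Q n h ->
    Q n.+1 (x * h)) ->
  forall n h, word H g n h -> exists2 m, (m <= n)%N & Q m h.
Proof.
move=> Q0 QS n _ [w [sw wP ->]]; exists (size w) => // {n sw}.
elim: w wP => [|x w IH] wP /=; first by rewrite big_nil.
rewrite big_cons; apply: QS; first by apply: wP; rewrite mem_head.
by apply: IH => y yw; apply: wP; rewrite in_cons yw orbT.
Qed.

(** Each letter [f] or [f^-1] expands to at most [m] letters; [0 < m] leaves room for the letters of
    [H], which are kept. *)
Lemma word_subst (H : set (Sym M)) g f m n h : (0 < m)%N ->
  word H g m f -> word H g m f^-1 -> word H f n h -> word H g (m * n) h.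
Proof.
move=> m0 gf gfV /(word_ind (Q := fun n => word H g (m * n)%N))[||k kn].
- by rewrite muln0; exact: word0.
- move=> k x y xP yP; rewrite mulnS; apply: wordM => //.
  case: xP => [->//|->//|Hx]; apply: wordW m0 _; apply: word1.
  by constructor 3.
- by apply: wordW; rewrite leq_mul2l kn orbT.
Qed.

Lemma wordV (H : set (Sym M)) g n h : (forall x, H x -> H x^-1) ->
  word H g n h -> word H g n h^-1.
Proof.
move=> HV /(word_ind (Q := fun n h => word H g n h^-1))[||k kn].
- by rewrite invg1; exact: word0.
- move=> k x y xP yP; rewrite invgM -addn1; apply: wordM => //; apply: word1.
  case: xP => [->|->|/HV Hx]; [by constructor 2|constructor 1|by constructor 3].
  by rewrite invgK.
- exact: wordW.
Qed.

Lemma word_subgroup (H : set (Sym M)) g n h : G g -> H `<=` G ->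
  word H g n h -> G h.
Proof.
move=> Gg HsG /(word_ind (Q := fun _ h => G h))[||//]; first exact: subgroup1.
move=> _ x y [->|->|/HsG Gx] Gy; apply: subgroupM => //; exact: subgroupV.
Qed.

Lemma stabilizerV a g : stabilizer G a g -> stabilizer G a g^-1.
Proof.
move=> [Gg ga]; split; first exact: subgroupV.
by rewrite -[in LHS]ga /= sym_funK.
Qed.

Lemma stabilizer_maximal a g : (G `\` stabilizer G a) g ->
  forall h, G h -> exists n, word (stabilizer G a) g n h.
Proof.
move=> [Gg nga] h Gh.
have HsG : stabilizer G a `<=` G by move=> x [].
(* [W] is the subgroup generated by [g] and the stabilizer of [a]. *)
pose W := fun h => exists n, word (stabilizer G a) g n h.
have WG x : W x -> G x by move=> [n]; exact: word_subgroup.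
have WM x y : W x -> W y -> W (x * y).
  by move=> [m xm] [n yn]; exists (m + n)%N; exact: wordM.
have WV x : W x -> W x^-1.
  by move=> [n xn]; exists n; apply: wordV => // ?; exact: stabilizerV.
have WH x : stabilizer G a x -> W x.
  by move=> Hx; exists 1%N; apply: word1; constructor 3.
have W1 : W 1 by exists 0%N; exact: word0.
(* [c] and [d] lie in a common translate by [k] of the orbit of [a] under [W]. Once primitivity
   makes [E] total, [W] is transitive; containing the stabilizer of [a], it is all of [G]. *)
pose E c d := exists k x, [/\ G k, W x, k a = c & k (x a) = d].
have Ea : forall c d, E c d.
  apply: (@primitive_equivalence E _ _ _ _ a (g a)).
  - move=> c; have [k Gk <-] := Gprim.1 a c.
    by exists k, 1; split.
  - move=> c d [k [x [Gk Wx <- <-]]]; exists (k * x), x^-1.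
    split=> //; [exact/subgroupM/WG|exact: WV|by rewrite /= sym_invK].
  - move=> c d e [k [x [Gk Wx <- <-]]] [k' [y [Gk' Wy k'a <-]]].
    (* Both [k * x] and [k'] send [a] to the middle point, so [(k * x)^-1 * k'] fixes [a] and lies
       in [W]. *)
    exists k, (x * ((k * x)^-1 * k') * y); split=> //; last first.
      by rewrite !mulgA invgM /= !sym_invK.
    apply/WM => //; apply/WM => //; apply: WH; split.
      by apply: subgroupM => //; apply/subgroupV/subgroupM => //; exact: WG.
    by rewrite /= k'a !sym_funK.
  - move=> l c d Gl [k [x [Gk Wx <- <-]]]; exists (l * k), x.
    by split=> //; exact: subgroupM.
  - by move=> aga; apply: nga; split.
  - exists 1, g; split=> //; first exact: subgroup1.
    by exists 1%N; apply: word1; constructor 1.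
have [k [x [Gk Wx ka kxa]]] := Ea a (h a).
have Wk : W k by apply: WH.
have -> : h = k * x * (h^-1 * (k * x))^-1 by rewrite invgM invgK mulVKg.
apply: (WM) => //; first exact: WM.
apply/WV/WH; split; last by rewrite /= kxa sym_funK.
apply: subgroupM; [exact: subgroupV|by apply: subgroupM => //; exact: WG].
Qed.

End PermutationGroupTheory.

(** * Roelcke precompactness implies conditions (i) and (ii) *)

Section RoelckePrecompact.
Variables (M : countType) (G : set (Sym M)).
Hypotheses (HG : subgroup G) (Gprim : primitive G) (Gnoalg : no_algebraicity G).
Implicit Types (a b c : M) (g h k : Sym M).
Local Open Scope group_scope.

Lemma nbhs_pointwise_stabilizer (s : seq M) :
  within G (nbhs (1 : Sym M)) (pointwise_stabilizer G [set` s]).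
Proof.
suff: nbhs (1 : Sym M) [set g : Sym M | forall a, a \in s -> g a = a].
  by apply: filterS => g gs Gg; split.
elim: s => [|a s IH]; first exact: filterE.
have aE : nbhs (1 : Sym M) [set g : Sym M | g a = a].
  have ca : {for (1 : Sym M), continuous (fun g : Sym M =>
      (g a : discrete_topology M))}.
    apply: (@continuous_comp _ _ _ (@sym_ptws M)
      (fun f : {ptws M -> discrete_topology M} => f a)).
      exact: initial_continuous.
    exact: (@proj_continuous _ (fun=> discrete_topology M)).
  exact: ca (discrete_set1 _).
apply: filterS2 aE IH => g ga gs b; rewrite in_cons => /predU1P[->//|].
exact: gs.
Qed.

Hypothesis Grp : roelcke_precompact G.

Lemma roelcke_stabilizer (s : seq M) : exists F : set (Sym M),
  [/\ finite_set F, F `<=` G & forall g, G g -> exists u f v,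
    [/\ pointwise_stabilizer G [set` s] u, F f,
        pointwise_stabilizer G [set` s] v & g = u * f * v]].
Proof.
have [||F [Ffin FG GE]] := @Grp (pointwise_stabilizer G [set` s]).
- by move=> g [].
- exact: nbhs_pointwise_stabilizer.
exists F; split=> // g Gg; have := Gg.
by rewrite {1}GE => -[_ [u us [f Ff <-]] [v vs <-]]; exists u, f, v.
Qed.

Lemma roelcke_finite_orbits (s : seq M) : exists2 D : set M, finite_set D &
  forall c, exists k d, [/\ pointwise_stabilizer G [set` s] k, D d & k d = c].
Proof.
have [[a _]|noM] := pselect ([set: M] !=set0); last first.
  by exists set0 => // c; case: noM; exists c.
(* With [a] adjoined to [s], the right factor [v] fixes [a]; hence [g a = u (f a)], and the points
   [f a] represent all orbits. *)
have [F [Ffin FG GE]] := roelcke_stabilizer (a :: s).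
exists [set f a | f in F]; first exact: finite_image.
move=> c; have [g Gg gac] := Gprim.1 a c.
have [u [f [v [us Ff vs gE]]]] := GE _ Gg.
exists u, (f a); split; [|by exists f|].
- split; first by case: us.
  by move=> b bs; apply: us.2; rewrite /= in_cons bs orbT.
- by rewrite -gac gE /= vs.2//= mem_head.
Qed.

(** The finite set [F] meets every double coset of the stabilizer. By maximality each [f] in [F]
    outside the stabilizer generates every member of [F], and finitely many pairs give a uniform
    length [N]. *)
Lemma roelcke_boundedly_maximal a : boundedly_maximal G (stabilizer G a).
Proof.
have sE : pointwise_stabilizer G [set` [:: a]] `<=` stabilizer G a.
  by move=> g [Gg ga]; split=> //; apply: ga; rewrite /= mem_head.
have [F [Ffin FG GE]] := roelcke_stabilizer [:: a].
have wP f h : exists n, F f -> ~ stabilizer G a f -> F h ->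
    word (stabilizer G a) f n h.
  have [[Ff [nf Fh]]|nP] := pselect (F f /\ ~ stabilizer G a f /\ F h).
    have nGf : (G `\` stabilizer G a) f by split=> //; exact: FG.
    by have [n nh] := stabilizer_maximal HG Gprim nGf (FG _ Fh); exists n.
  (* Dummy length for irrelevant pairs, so that [len] is total. *)
  by exists 0%N => Ff nf Fh; case: nP.
pose len f h := sval (cid (wP f h)).
have lenP f h : F f -> ~ stabilizer G a f -> F h ->
  word (stabilizer G a) f (len f h) h by exact: svalP (cid (wP f h)).
have [N lenN] : exists N, forall f h, F f -> F h -> (len f h <= N)%N.
  have /finite_seqP[r rE] : finite_set [set len p.1 p.2 | p in F `*` F].
    by apply: finite_image; exact: finite_setX.
  exists (\max_(i <- r) i)%N => f h Ff Fh; apply: leq_bigmax_seq => //.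
  have : [set len p.1 p.2 | p in F `*` F] (len f h) by exists (f, h).
  by rewrite rE.
(* The element [f] costs three letters, as [u^-1 * g * v^-1]; [f'] is a word of length [N] in [f];
   [u'] and [v'] add one letter each. *)
exists (1 + 3 * N + 1)%N => g [Gg nga] h Gh.
have [u [f [v [/sE us Ff /sE vs gE]]]] := GE _ Gg.
have [u' [f' [v' [/sE us' Ff' /sE vs' ->]]]] := GE _ Gh.
have nf : ~ stabilizer G a f.
  move=> [Gf fa]; apply: nga; split=> //.
  by rewrite gE /= vs.2 fa us.2.
have gH x : stabilizer G a x -> word (stabilizer G a) g 1 x.
  by move=> Hx; apply: word1; constructor 3.
have HV := @stabilizerV _ _ HG a.
have gf : word (stabilizer G a) g 3 f.
  have -> : f = u^-1 * g * v^-1 by rewrite gE -!mulgA mulKg mulgV mulg1.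
  apply: (wordM (m := 2) (n := 1)); last by apply: gH; exact: HV.
  apply: (wordM (m := 1) (n := 1)); first by apply: gH; exact: HV.
  by apply: word1; constructor 1.
change (word (stabilizer G a) g (1 + 3 * N + 1)%N (u' * f' * v')).
apply: wordM; last exact: gH.
apply: wordM; first exact: gH.
apply: (@word_subst _ _ _ f) => //; first exact: wordV.
by apply: wordW (lenP _ _ Ff nf Ff'); exact: lenN.
Qed.

Lemma same_type_refl (s : seq M) : same_type G s s.
Proof. by exists 1; [exact: subgroup1 | rewrite map_id]. Qed.

Lemma same_type_sym (s t : seq M) : same_type G s t -> same_type G t s.
Proof.
move=> [g Gg <-]; exists g^-1; first exact: subgroupV.
by rewrite -map_comp map_id_in // => x _ /=; rewrite sym_funK.
Qed.

(** Pulling [x m (size s)] back along the permutation that matches the initial segments gives a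
    point in one of finitely many orbits over [s]; the pigeonhole principle selects one orbit. *)
Lemma roelcke_type_extension (x : nat -> nat -> M) (s : seq M) :
  infinite_set [set m | same_type G s (mkseq (x m) (size s))] ->
  exists c, infinite_set
    [set m | same_type G (rcons s c) (mkseq (x m) (size s).+1)].
Proof.
apply: contra_notP => /forallNP fin.
have [D Dfin DP] := roelcke_finite_orbits s.
have : finite_set (\bigcup_(d in D)
    [set m | same_type G (rcons s d) (mkseq (x m) (size s).+1)]).
  by apply: bigcup_finite => // d _; exact: contrapT (fin d).
apply: sub_finite_set => m /= [g Gg gs].
have [k [d [[Gk ks] Dd kd]]] := DP (g^-1 (x m (size s))).
exists d => //; exists (g * k); first exact: subgroupM.
rewrite map_rcons mkseqS -gs /= kd sym_invK; congr rcons.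
by apply/eq_in_map => b bs /=; rewrite ks.
Qed.

(* Koenig's lemma: the tree of types of finite tuples is finitely branching. *)
Lemma roelcke_type_compactness (x : nat -> nat -> M) : exists y : nat -> M,
  forall n, infinite_set [set m | same_type G (mkseq y n) (mkseq (x m) n)].
Proof.
have next_ex (s : seq M) : exists c,
    infinite_set [set m | same_type G s (mkseq (x m) (size s))] ->
    infinite_set [set m | same_type G (rcons s c) (mkseq (x m) (size s).+1)].
  have [/roelcke_type_extension[c cP]|nP] := pselect (infinite_set
    [set m | same_type G s (mkseq (x m) (size s))]); first by exists c.
  by exists (x 0%N 0%N).
have [next nextP] := choice next_ex.
pose init n := iter n (fun s => rcons s (next s)) [::].
have initE n : mkseq (fun n => next (init n)) n = init n.
  by elim: n => // n IH; rewrite mkseqS IH.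
exists (fun n => next (init n)); elim=> [|n].
  rewrite (_ : [set m | _] = setT); first exact: infinite_nat.
  by rewrite -subTset => m _; exact: same_type_refl.
rewrite mkseqS initE => IH.
have sz : size (init n) = n by rewrite -initE size_mkseq.
by have := nextP (init n); rewrite sz; apply.
Qed.

Lemma moved_off (s : seq M) a : a \notin s ->
  exists2 g, pointwise_stabilizer G [set` s] g & g a <> a.
Proof.
move=> /negP/(Gnoalg (finite_seq s))/infinite_setD/(_ (finite_set1 a)).
by move=> /infinite_setN0[_ [[g gs <-] /= ga]]; exists g.
Qed.

Lemma map_pointwise_stabilizer (s : seq M) g :
  pointwise_stabilizer G [set` s] g -> map g s = s.
Proof. by move=> [_ gs]; rewrite map_id_in // => x xs; exact: gs. Qed.

Lemma roelcke_uniform_non_algebraicity : uniform_non_algebraicity G.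
Proof.
split=> [b a /moved_off[g gb ga]|b a ba].
  exists b, (g a), a; split; [exact: ga| |exact: same_type_refl].
  apply: same_type_sym; exists g; first by case: gb.
  by rewrite map_rcons map_pointwise_stabilizer.
have mv m : exists2 g, pointwise_stabilizer G [set` mkseq b m] g & g a <> a.
  by apply: moved_off; apply/mapP => -[i _ /esym]; exact: ba.
have [g gb ga] : exists2 g : nat -> Sym M,
    forall m, pointwise_stabilizer G [set` mkseq b m] (g m) &
    forall m, g m a <> a.
  exists (fun m => sval (cid2 (mv m))) => m; by case: cid2.
(* The sequence [g m a, a, b 0, b 1, ...]: from index 2 on, the default value of [nth] supplies [b].
   In a limit [y] of these types, [y 0] and [y 1] serve as [a'] and [a'']. *)
pose x m := fun n => nth (b n.-2) [:: g m a; a] n.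
have [y yP] := roelcke_type_compactness x.
have mkE (z : nat -> M) n :
    mkseq z n.+2 = z 0%N :: z 1%N :: mkseq (fun i => z i.+2) n.
  by rewrite /mkseq /= -[2]addn0 iotaDl -map_comp.
have xE m n : mkseq (x m) n.+2 = [:: g m a, a & mkseq b n].
  rewrite mkE; congr [:: _, _ & _]; apply: eq_mkseq => i.
  by rewrite /x /= nth_nil.
(* Infinitely many [m] realize the type, so one can take [m] at least [n]; then [g m] fixes the
   first [n] entries of [b]. *)
have yE n : exists2 m, (n <= m)%N &
    same_type G [:: y 0%N, y 1%N & mkseq (fun i => y i.+2) n]
      [:: g m a, a & mkseq b n].
  have /infinite_setD/(_ (finite_II n))/infinite_setN0 := yP n.+2.
  move=> [m [/= ty /negP]].
  by rewrite -leqNgt => nm; exists m => //; rewrite -xE -mkE.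
exists (fun i => y i.+2), (y 0%N), (y 1%N); split.
- move=> y01; have [m _ [h Gh /= [h0 h1]]] := yE 0%N.
  by apply: (ga m); rewrite -h0 -h1 y01.
- move=> n; have [m nm [h Gh /= [h0 h1 hn]]] := yE n.
  have [Gg gfix] := gb m.
  (* Conjugating by [h], this sends [y 0] through [g m a] and [a] to [y 1], and it fixes the first
     [n] entries of the new tuple. *)
  exists (h^-1 * (g m)^-1 * h).
    by apply: subgroupM => //; apply: subgroupM => //; exact: subgroupV.
  rewrite map_rcons /= h0 sym_funK -h1 sym_funK; congr rcons.
  rewrite -[in RHS](map_id (mkseq _ n)); apply/eq_in_map => c cy /=.
  have hc : h c \in mkseq b n by rewrite -hn map_f.
  have -> : sym_inv (g m) (h c) = h c.
    rewrite -[in LHS](gfix (h c)) ?sym_funK//=.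
    move: hc => /mapP[i]; rewrite mem_iota /= => ni ->; apply: map_f.
    by rewrite mem_iota /=; apply: leq_trans nm.
  by rewrite sym_funK.
- move=> n; have [m _ [h Gh /= [_ h1 hn]]] := yE n.
  by exists h => //; rewrite map_rcons hn h1.
Qed.

End RoelckePrecompact.

(** * Bounded measurable functions and their squared distance *)

Section BoundedMeasurable.
Context d (T : measurableType d) (R : realType) (mu : probability T R).
Local Open Scope ring_scope.
Implicit Types (f h k : T -> R).

(** Boundedness keeps the class closed under products, so all integrals below are finite. *)
Definition bmf f := measurable_fun setT f /\ exists C, forall x, `|f x| <= C.

Local Notation I := (Rintegral mu setT).

Lemma bmf_integrable f : bmf f -> mu.-integrable setT (EFin \o f).
Proof.
move=> [mf [C fC]]; apply: measurable_bounded_integrable => //.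
  by rewrite -ge0_fin_numE// fin_num_measure.
exists C; split; first exact: num_real.
by move=> x Cx y _; apply: le_trans (fC y) (ltW Cx).
Qed.

Lemma bmf_cst r : bmf (cst r).
Proof. by split; [exact: measurable_cst | exists `|r|]. Qed.

Lemma bmfD f h : bmf f -> bmf h -> bmf (fun x => f x + h x).
Proof.
move=> [mf [C fC]] [mh [D hD]]; split; first exact: measurable_funD.
by exists (C + D) => x; rewrite (le_trans (ler_normD _ _))// lerD.
Qed.

Lemma bmfM f h : bmf f -> bmf h -> bmf (fun x => f x * h x).
Proof.
move=> [mf [C fC]] [mh [D hD]]; split; first exact: measurable_funM.
by exists (C * D) => x; rewrite normrM ler_pM.
Qed.

Lemma bmfZ r f : bmf f -> bmf (fun x => r * f x).
Proof. by move=> bf; apply: bmfM => //; exact: bmf_cst. Qed.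

Lemma bmfB f h : bmf f -> bmf h -> bmf (fun x => f x - h x).
Proof.
move=> bf /(bmfZ (-1)) bh; have := bmfD bf bh.
by congr bmf; apply/funext => x; rewrite mulN1r.
Qed.

Lemma bmf_sqr f : bmf f -> bmf (fun x => f x ^+ 2).
Proof. by move=> bf; apply: bmfM. Qed.

Lemma bmf_unit_interval f : measurable_fun setT f ->
  (forall x, 0 <= f x <= 1) -> bmf f.
Proof.
move=> mf f01; split=> //; exists 1 => x.
by have /andP[f0 f1] := f01 x; rewrite ger0_norm.
Qed.

Lemma bmf_clamp f : bmf f -> bmf (fun x => Num.max 0 (Num.min 1 (f x))).
Proof.
move=> [mf _]; apply: bmf_unit_interval; last first.
  by move=> x; rewrite le_max lexx/= ge_max ler01 ge_min lexx.
by apply: measurable_maxr => //; exact: measurable_minr.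
Qed.

Lemma bmf_comp (phi : T -> T) f : measurable_fun setT phi -> bmf f ->
  bmf (f \o phi).
Proof.
move=> mphi [mf [C fC]]; split; first exact: measurableT_comp.
by exists C => x /=.
Qed.

Lemma meanB f h : bmf f -> bmf h -> I (fun x => f x - h x) = I f - I h.
Proof. by move=> bf bh; apply: RintegralB => //; exact: bmf_integrable. Qed.

Lemma meanD f h : bmf f -> bmf h -> I (fun x => f x + h x) = I f + I h.
Proof. by move=> bf bh; apply: RintegralD => //; exact: bmf_integrable. Qed.

Lemma meanZ r f : bmf f -> I (fun x => r * f x) = r * I f.
Proof. by move=> bf; apply: RintegralZl => //; exact: bmf_integrable. Qed.

Lemma le_mean f h : bmf f -> bmf h -> (forall x, f x <= h x) -> I f <= I h.
Proof.
by move=> bf bh fh; apply: le_Rintegral => //; exact: bmf_integrable.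
Qed.

Lemma mean_cst r : I (cst r) = r.
Proof. by rewrite Rintegral_cst//= probability_setT mulr1. Qed.

(** The square of the $L^2$ distance; avoiding the root costs a factor 2 in the triangle
    inequality. *)
Definition sqdist f h := I (fun x => (f x - h x) ^+ 2).

Lemma sqdist_ge0 f h : 0 <= sqdist f h.
Proof. by apply: Rintegral_ge0 => x _; exact: sqr_ge0. Qed.

Lemma sqdistC f h : sqdist f h = sqdist h f.
Proof. by congr I; apply/funext => x; rewrite -sqrrN opprB. Qed.

Lemma sqdist_xx f : sqdist f f = 0.
Proof.
rewrite /sqdist -[RHS](mean_cst 0); congr I.
by apply/funext => x; rewrite subrr expr0n.
Qed.

Lemma bmf_sqrB f h : bmf f -> bmf h -> bmf (fun x => (f x - h x) ^+ 2).
Proof. by move=> bf bh; apply: bmf_sqr; exact: bmfB. Qed.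

Local Hint Resolve bmfZ bmfD bmfB bmf_sqrB : bmf.

Lemma sqdist_triangle f h k : bmf f -> bmf h -> bmf k ->
  sqdist f k <= 2 * sqdist f h + 2 * sqdist h k.
Proof.
move=> bf bh bk; rewrite /sqdist -!meanZ -?meanD; auto with bmf.
apply: le_mean; auto with bmf => x.
have := sqr_ge0 ((f x - h x) - (h x - k x)); lra.
Qed.

Lemma sqdist_parallelogram f h k : bmf f -> bmf h -> bmf k ->
  sqdist h k = 2 * sqdist f h + 2 * sqdist f k
    - 4 * sqdist f (fun x => 2^-1 * (h x + k x)).
Proof.
move=> bf bh bk; rewrite /sqdist -!meanZ -?meanD -?meanB; auto with bmf.
by congr I; apply/funext => x; lra.
Qed.

End BoundedMeasurable.

(** * Almost everywhere limits and ergodicity *)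

Section ErgodicLimit.
Context d (T : measurableType d) (R : realType) (mu : probability T R).
Local Open Scope ring_scope.
Local Notation I := (Rintegral mu setT).

(** The series of [4 ^+ n * f n] has integral at most [2 * C], so it is finite almost everywhere and
    its sum bounds every term. *)
Lemma ae_geometric_bound (f : nat -> T -> R) (C : R) :
  (forall n, bmf (f n)) -> (forall n x, 0 <= f n x) ->
  (forall n, I (f n) <= C * 8^-1 ^+ n) ->
  {ae mu, forall x, exists K, forall n, f n x <= K * 4^-1 ^+ n}.
Proof.
move=> bf f0 fC; pose g n x := (4 ^+ n * f n x)%:E.
have g0 n x : (0 <= g n x)%E by rewrite lee_fin mulr_ge0// exprn_ge0.
have mg n : measurable_fun setT (g n).
  by apply/measurable_EFinP; have [] := bmfZ (4 ^+ n) (bf n).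
have C0 : 0 <= C.
  by have := fC 0%N; rewrite expr0 mulr1; apply: le_trans; apply: Rintegral_ge0.
have gC n : (\int[mu]_x g n x <= (C * 2^-1 ^+ n)%:E)%E.
  rewrite -[leLHS]fineK; last first.
    by apply: integrable_fin_num => //; apply: bmf_integrable; exact: bmfZ.
  rewrite lee_fin -[leLHS]/(I (fun x => 4 ^+ n * f n x)) meanZ//.
  apply: le_trans (ler_wpM2l _ (fC n)) _; first exact: exprn_ge0.
  by rewrite mulrCA -exprMn (_ : 4 * 8^-1 = 2^-1)//; lra.
have sum_le n : (\sum_(0 <= k < n) \int[mu]_x g k x <= (C * 2)%:E)%E.
  apply: (@le_trans _ _ (\sum_(0 <= k < n) (C * 2^-1 ^+ k)%:E)%E).
    by apply: lee_sum => k _; exact: gC.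
  rewrite sumEFin lee_fin -mulr_sumr ler_wpM2l//.
  have -> : \sum_(0 <= k < n) 2^-1 ^+ k = series (geometric 1 2^-1) n :> R.
    by apply: eq_bigr => k _; rewrite /= mul1r.
  rewrite geometric_seriesE /=; last by rewrite lt_eqF//; lra.
  rewrite (_ : 1 - 2^-1 = 2^-1) ?invrK; last lra.
  have : 0 <= (2^-1 : R) ^+ n by rewrite exprn_ge0.
  rewrite mul1r; lra.
have intg : mu.-integrable setT (fun x => \sum_(n <oo) g n x)%E.
  apply/integrableP; split.
    exact: (@ge0_emeasurable_sum _ _ _ _ g xpredT).
  under eq_integral.
    move=> x _; rewrite gee0_abs; last exact: nneseries_ge0.
    over.
  rewrite integral_nneseries//.
  apply: le_lt_trans (ltry (C * 2)); apply: lime_le; last exact: nearW.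
  by apply: is_cvg_nneseries => n _ _; exact: integral_ge0.
apply: filterS (integrable_ae measurableT intg) => x /(_ Logic.I) fin.
exists (fine (\sum_(n <oo) g n x)%E) => n.
rewrite exprVn ler_pdivlMr ?exprn_gt0// mulrC -lee_fin fineK//.
have := @nneseries_lim_ge R (g ^~ x) xpredT 0 n.+1 (fun n _ _ => g0 n x).
apply: le_trans; rewrite big_nat_recr//= leeDr//.
by rewrite sume_ge0.
Qed.

Lemma sqr_le_geometric (K z : R) n : 0 <= K ->
  z ^+ 2 <= K * 4^-1 ^+ n -> `|z| <= (K + 1) * 2^-1 ^+ n.
Proof.
move=> K0 zK; have K1 : 0 <= K + 1 by rewrite addr_ge0.
rewrite -(@ler_pXn2r _ 2)// ?nnegrE ?mulr_ge0 ?exprn_ge0//.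
rewrite real_normK ?num_real// (le_trans zK)// exprMn.
rewrite -exprM mulnC exprM (_ : 2^-1 ^+ 2 = 4^-1 :> R); last first.
  by rewrite expr2; lra.
by rewrite ler_wpM2r ?exprn_ge0// expr2; nra.
Qed.

Lemma geometric_sqdist_cvg (u : nat -> R) (K : R) :
  (forall n, (u n - u n.+1) ^+ 2 <= K * 4^-1 ^+ n) -> cvgn u.
Proof.
move=> uK; have K0 : 0 <= K.
  by have := uK 0%N; rewrite expr0 mulr1; apply: le_trans; exact: sqr_ge0.
rewrite (_ : u = (fun n => u 0%N + series (telescope u) n)); last first.
  by apply/funext => n; rewrite -eq_sum_telescope.
apply: is_cvgD; first exact: is_cvg_cst.
apply: normed_cvg; apply: (@series_le_cvg _ _ (geometric (K + 1) 2^-1)) => //.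
- by move=> n /=; exact: normr_ge0.
- by move=> n; apply: geometric_ge0; rewrite ?addr_ge0.
- move=> n; rewrite /telescope /= distrC; exact: sqr_le_geometric.
- by apply: is_cvg_geometric_series; rewrite ger0_norm//; lra.
Qed.

Lemma geometric_sqdist_cvg0 (u v : nat -> R) (K : R) :
  (forall n, (u n - v n) ^+ 2 <= K * 4^-1 ^+ n) ->
  (fun n => u n - v n) @ \oo --> (0 : R).
Proof.
move=> uK; have K0 : 0 <= K.
  by have := uK 0%N; rewrite expr0 mulr1; apply: le_trans; exact: sqr_ge0.
apply/norm_cvg0P.
apply: (@squeeze_cvgr _ _ _ _ (cst 0) (geometric (K + 1) 2^-1)).
- by apply: nearW => n; rewrite normr_ge0/=; exact: sqr_le_geometric.
- exact: cvg_cst.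
- by apply: cvg_geometric; rewrite ger0_norm//; lra.
Qed.

Lemma ae_eq_Rintegral0 (f : T -> R) : bmf f -> {ae mu, forall x, 0 <= f x} ->
  I f = 0 -> {ae mu, forall x, f x = 0}.
Proof.
move=> bf f0 If0; have intf := bmf_integrable mu bf.
have mf : measurable_fun setT (EFin \o f) by apply/measurable_EFinP; case: bf.
have : (\int[mu]_x `|(EFin \o f) x| = 0)%E.
  transitivity (\int[mu]_x (f x)%:E)%E.
    apply: ae_eq_integral => //; first exact: measurableT_comp.
    by apply: filterS f0 => x fx _ /=; rewrite ger0_norm.
  rewrite -[LHS]fineK; last exact: integrable_fin_num.
  by rewrite -[fine _]/(I f) If0.
move/(ae_eq_integral_abs mu measurableT mf).1.
by apply: filterS => x /(_ Logic.I) [].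
Qed.

(** The superlevel set at the mean suffices: if it is null or full, [f - I f] has constant sign
    almost everywhere and integral zero. *)
Lemma ae_eq_mean (f : T -> R) : bmf f ->
  mu [set x | I f < f x] = 0%E \/ mu [set x | I f < f x] = 1%E ->
  {ae mu, forall x, f x = I f}.
Proof.
move=> bf; have bI : bmf (cst (I f) : T -> R) by exact: bmf_cst.
have mE : measurable [set x | I f < f x].
  rewrite -[X in measurable X]setTI -preimage_itvoy.
  by case: bf => mf _; apply: mf => //; exact: measurable_itv.
case=> muE.
- have : {ae mu, forall x, I f - f x = 0}.
    apply: ae_eq_Rintegral0; first exact: bmfB.
      exists [set x | I f < f x]; split=> // x /= /negP.
      by rewrite subr_ge0 -ltNge.
    by rewrite meanB// mean_cst subrr.
  by apply: filterS => x /eqP; rewrite subr_eq0 => /eqP.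
- have : {ae mu, forall x, f x - I f = 0}.
    apply: ae_eq_Rintegral0; first exact: bmfB.
      exists (~` [set x | I f < f x]); split=> //; first exact: measurableC.
        by rewrite probability_setC// muE subee.
      move=> x /= /negP; rewrite subr_ge0 -ltNge => /ltW.
      by rewrite leNgt => /negP.
    by rewrite meanB// mean_cst subrr.
  by apply: filterS => x /eqP; rewrite subr_eq0 => /eqP.
Qed.

(** The rate [8^-1 ^+ n] forces almost everywhere convergence. The limit is invariant almost
    everywhere, hence constant, and dominated convergence passes this to integrals against [th]. *)
Lemma ergodic_limit (Phi : set (T -> T)) (eta : nat -> T -> R) (C : R) :
  (forall phi, Phi phi -> measurable_fun setT phi) ->
  (forall E, measurable E ->
    (forall phi, Phi phi -> mu ((phi @^-1` E) `+` E) = 0%E) ->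
    mu E = 0%E \/ mu E = 1%E) ->
  (forall n, measurable_fun setT (eta n)) ->
  (forall n x, 0 <= eta n x <= 1) ->
  (forall n, sqdist mu (eta n) (eta n.+1) <= C * 8^-1 ^+ n) ->
  (forall phi n, Phi phi ->
    sqdist mu (eta n) (eta n \o phi) <= C * 8^-1 ^+ n) ->
  exists p, forall th, bmf th ->
    (fun n => I (fun x => eta n x * th x)) @ \oo --> p * I th.
Proof.
move=> mPhi erg meta eta01 etaC etaphiC.
have beta n : bmf (eta n) by exact: bmf_unit_interval.
(* The upper limit is measurable and defined everywhere; clamping keeps it bounded where [eta]
   diverges. *)
pose zeta x := Num.max 0 (Num.min 1 (limn_sup (eta ^~ x))).
have zetaP x l : (eta n x @[n --> \oo] --> l) -> zeta x = l.
  move=> etal; have cl := cvg_lim (@Rhausdorff R) etal.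
  rewrite /zeta (cvg_limn_inf_sup etal).2.
  have l0 : 0 <= l.
    rewrite -cl; apply: limr_ge; first by apply/cvg_ex; exists l.
    by apply: nearW => n; case/andP: (eta01 n x).
  have l1 : l <= 1.
    rewrite -cl; apply: limr_le; first by apply/cvg_ex; exists l.
    by apply: nearW => n; case/andP: (eta01 n x).
  by rewrite (min_idPr l1) (max_idPr l0).
have mzeta : measurable_fun setT zeta.
  apply: measurable_maxr => //; apply: measurable_minr => //.
  apply: measurable_fun_limn_sup => // x _.
    by exists 1 => _ [n _ <-]; case/andP: (eta01 n x).
  by exists 0 => _ [n _ <-]; case/andP: (eta01 n x).
have bzeta : bmf zeta.
  apply: bmf_unit_interval => // x.
  by rewrite /zeta le_max lexx/= ge_max ler01 ge_min lexx.
have ae_lim : {ae mu, forall x, eta n x @[n --> \oo] --> zeta x}.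
  have := @ae_geometric_bound (fun n x => (eta n x - eta n.+1 x) ^+ 2) C
    (fun n => bmf_sqrB (beta n) (beta n.+1)) (fun n x => sqr_ge0 _) etaC.
  apply: filterS => x [K /geometric_sqdist_cvg/cvg_ex[l etal]].
  by rewrite (zetaP x l).
have ae_inv phi : Phi phi -> {ae mu, forall x, zeta (phi x) = zeta x}.
  move=> Pphi; have bphi n := bmf_comp (mPhi _ Pphi) (beta n).
  have := @ae_geometric_bound (fun n x => (eta n x - eta n (phi x)) ^+ 2) C
    (fun n => bmf_sqrB (beta n) (bphi n)) (fun n x => sqr_ge0 _)
    (fun n => etaphiC _ n Pphi).
  apply: filterS2 ae_lim => x cvgz [K /geometric_sqdist_cvg0 cvg0].
  (* Convergence at [phi x] is deduced from convergence at [x], since the difference of the two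
     sequences tends to 0. *)
  apply: zetaP; rewrite -[zeta x]subr0 (_ : (fun n => eta n (phi x)) =
    (fun n => eta n x) - (fun n => eta n x - eta n (phi x))); first exact: cvgB.
  by apply/funext => n; rewrite !fctE opprB addrC subrK.
have ae_cst : {ae mu, forall x, zeta x = I zeta}.
  have mE : measurable [set x | I zeta < zeta x].
    rewrite -[X in measurable X]setTI -preimage_itvoy.
    by apply: mzeta => //; exact: measurable_itv.
  apply: ae_eq_mean => //; apply: erg => // phi Pphi.
  have mphiE : measurable (phi @^-1` [set x | I zeta < zeta x]).
    by rewrite -[X in measurable X]setTI; exact: mPhi.
  apply: measure_negligible.
    by rewrite /setY; apply: measurableU; exact: measurableD.
  apply: negligibleS (ae_inv _ Pphi) => x /= xE eqx.
  by move: xE; rewrite /setY /= eqx => -[[]|[]].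
exists (I zeta) => th bth.
have [C' thC] := bth.2.
have [|||||_ _] := @dominated_convergence _ _ _ mu setT measurableT
  (fun n x => (eta n x * th x)%:E) (fun x => (I zeta * th x)%:E) (cst C'%:E).
- by move=> n; apply/measurable_EFinP; case: (bmfM (beta n) bth).
- by apply/measurable_EFinP; case: (bmfZ (I zeta) bth).
- apply: filterS2 ae_lim ae_cst => x cvgz <- _.
  by apply: cvg_EFin; [exact: nearW | exact: cvgMr_tmp].
- exact: finite_measure_integrable_cst.
- apply: aeW => x n _; rewrite lee_fin normrM.
  have /andP[e0 e1] := eta01 n x.
  by rewrite ger0_norm// (le_trans _ (thC x))// ler_piMl.
move=> cvgI; rewrite -meanZ//; apply: fine_cvg; rewrite fineK//.
by apply: integrable_fin_num => //; apply: bmf_integrable; exact: bmfZ.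
Qed.

End ErgodicLimit.

Lemma continuous_borel_measurable (T U : ptopologicalType) (f : T -> U) :
  continuous f -> measurable_fun [set: borel T] (f : borel T -> borel U).
Proof.
move=> /continuousP cf.
apply: (@measurability _ _ (borel T) (borel U) setT f (@open U)) => //.
move=> _ [V oV <-]; rewrite setTI; apply: sub_sigma_algebra; exact: cf.
Qed.

(** * The shift action on the cube and functions of finitely many coordinates *)

Section Cube.
Variables (R : realType) (M : countType) (G : set (Sym M)).
Hypotheses (HG : subgroup G) (Gprim : primitive G) (Gnoalg : no_algebraicity G).
Variable mu : probability (borel (cube R M)) R.
Hypotheses (mu_inv : invariant_measure G mu) (mu_erg : ergodic G mu).
Local Open Scope ring_scope.
Local Notation I := (Rintegral mu setT).
Local Notation X := (borel (cube R M)).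
Implicit Types (a b c : M) (g h : Sym M) (s : seq M) (f : X -> R).

Definition coord a (w : X) : borel (unit_interval R) := w a.

Lemma measurable_coord a : measurable_fun setT (coord a).
Proof.
apply: continuous_borel_measurable.
exact: (@proj_continuous _ (fun=> unit_interval R)).
Qed.

(** The shift by [g^-1]; precomposition with it is a left action of permutations on functions. *)
Definition reindex g (w : X) : X := fun a => w (g a).

Lemma continuous_reindex g : continuous (reindex g : cube R M -> cube R M).
Proof.
move=> w; have FF : Filter ((reindex g : cube R M -> cube R M) @ nbhs w).
  exact: fmap_filter.
apply: (@cvg_sup (cube R M) M (fun a => Topological.class
  (initial_topology (fun f : M -> unit_interval R => f a)))
  _ (reindex g w) FF).2 => a U [V [[W oW WV] Wga VU]].
have : nbhs w ((fun v : cube R M => v (g a)) @^-1` W).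
  apply: (@proj_continuous _ (fun=> unit_interval R) (g a) w).
  by apply: open_nbhs_nbhs; split=> //; rewrite -WV in Wga.
by apply: filterS => v Wv; apply: VU; rewrite -WV.
Qed.

Lemma measurable_reindex g : measurable_fun setT (reindex g).
Proof. by apply: continuous_borel_measurable; exact: continuous_reindex. Qed.

Lemma cube_shift_image g (E : set X) : cube_shift g @` E = reindex g @^-1` E.
Proof.
rewrite eqEsubset; split=> [_ [w Ew <-]|w /= Ew].
  rewrite /preimage/= (_ : reindex g _ = w)//.
  by apply/funext => a; rewrite /reindex /cube_shift /= sym_funK.
exists (reindex g w) => //; apply/funext => a.
by rewrite /reindex /cube_shift /= sym_invK.
Qed.

Lemma mean_reindex g f : G g -> bmf f -> I (f \o reindex g) = I f.
Proof.
move=> Gg bf; have mf : measurable_fun setT (EFin \o f).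
  by apply/measurable_EFinP; case: bf.
have int : mu.-integrable setT ((EFin \o f) \o reindex g).
  by apply: bmf_integrable; apply: bmf_comp bf; exact: measurable_reindex.
rewrite /Rintegral; congr fine.
transitivity (\int[pushforward mu (reindex g)]_x (EFin \o f) x)%E.
  by rewrite integral_pushforward//; exact: measurable_reindex.
apply: eq_measure_integral => [|? E mE _]; first exact: measurable_reindex.
rewrite /= /pushforward -cube_shift_image; exact: mu_inv.
Qed.

Lemma sqdist_reindex g f1 f2 : G g -> bmf f1 -> bmf f2 ->
  sqdist mu (f1 \o reindex g) (f2 \o reindex g) = sqdist mu f1 f2.
Proof. by move=> Gg b1 b2; exact: mean_reindex Gg (bmf_sqrB b1 b2). Qed.

Definition depends_on s f :=
  forall w w' : X, (forall c, c \in s -> w c = w' c) -> f w = f w'.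

Lemma depends_on_reindex g s f :
  depends_on s f -> depends_on (map g s) (f \o reindex g).
Proof.
by move=> sf w w' ww'; apply: sf => c cs; apply: ww'; exact: map_f.
Qed.

Lemma depends_on_fixed g s f : (forall c, c \in s -> g c = c) ->
  depends_on s f -> f \o reindex g = f.
Proof.
move=> gs sf; apply/funext => w; apply: sf => c cs.
by rewrite /reindex gs.
Qed.

(** With finite support, [f] is fixed exactly by every permutation fixing that support pointwise. *)
Definition local_off a f := bmf f /\ exists2 s, a \notin s & depends_on s f.

Lemma local_off_comp2 (op : R -> R -> R) a f1 f2 :
  bmf (fun w => op (f1 w) (f2 w)) -> local_off a f1 -> local_off a f2 ->
  local_off a (fun w => op (f1 w) (f2 w)).
Proof.
move=> bop [_ [s1 as1 s1f]] [_ [s2 as2 s2f]]; split=> //.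
exists (s1 ++ s2); first by rewrite mem_cat negb_or as1.
move=> w w' ww'; congr op; [apply: s1f|apply: s2f] => c cs; apply: ww'.
  by rewrite mem_cat cs.
by rewrite mem_cat cs orbT.
Qed.

Lemma local_off_cst a r : local_off a (cst r).
Proof. by split; [exact: bmf_cst | exists [::]]. Qed.

Lemma local_off_reindex g a f :
  local_off a f -> local_off (g a) (f \o reindex g).
Proof.
move=> [bf [s as_ sf]]; split.
  by apply: bmf_comp bf; exact: measurable_reindex.
exists (map g s); last exact: depends_on_reindex.
by rewrite mem_map//; exact: can_inj (sym_funK g).
Qed.

(** * Near minimizers and closeness of coordinates *)

Variable B : set (borel (unit_interval R)).
Hypothesis mB : measurable B.

Definition xi a (w : X) : R := \1_B (coord a w).

Lemma xi01 a w : 0 <= xi a w <= 1.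
Proof. by rewrite /xi indicE; case: (_ \in _); rewrite ?lexx ler01. Qed.

Lemma bmf_xi a : bmf (xi a).
Proof.
apply: bmf_unit_interval; last exact: xi01.
by apply: (measurableT_comp (measurable_indic mB)); exact: measurable_coord.
Qed.

(** The infimum also runs over [a]: by transitivity and invariance every coordinate has the same
    one. *)
Definition min_sqdist := inf [set r | exists a f,
  local_off a f /\ r = sqdist mu (xi a) f].

Lemma min_sqdist_le a f : local_off a f -> min_sqdist <= sqdist mu (xi a) f.
Proof.
move=> af; apply: ge_inf; last by exists a, f.
by exists 0 => _ [b [h [_ ->]]]; exact: sqdist_ge0.
Qed.

(* A near minimizer stands for the conditional expectation of [xi a] given the
   coordinates other than [a]. *)
Definition near_min a (e : R) f :=
  [/\ local_off a f, forall w, 0 <= f w <= 1 &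
      sqdist mu (xi a) f <= min_sqdist + e].

Lemma near_min_bmf a e f : near_min a e f -> bmf f.
Proof. by case=> -[]. Qed.

Lemma near_minW a e e' f : e <= e' -> near_min a e f -> near_min a e' f.
Proof. by move=> ee' [? ? fe]; split=> //; rewrite (le_trans fe)// lerD2l. Qed.

Lemma near_min_reindex g a e f : G g ->
  near_min a e f -> near_min (g a) e (f \o reindex g).
Proof.
move=> Gg [af f01 fe]; split; [exact: local_off_reindex|by move=> w /=|].
by rewrite -(sqdist_reindex Gg (bmf_xi a) af.1) in fe.
Qed.

Lemma near_min_ex a e : 0 < e -> exists f, near_min a e f.
Proof.
move=> e0; have [] := @inf_adherent _ [set r | exists a f,
  local_off a f /\ r = sqdist mu (xi a) f] e e0.
  split; last by exists 0 => _ [b [h [_ ->]]]; exact: sqdist_ge0.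
  exists (sqdist mu (xi a) (cst 0)), a, (cst 0).
  by split=> //; exact: local_off_cst.
move=> _ [b [f [bf ->]]] fe; have [g Gg gba] := Gprim.1 b a.
(* Clamping to the unit interval does not increase the distance to [xi b], which takes values
   there. *)
pose f' w := Num.max 0 (Num.min 1 (f w)).
have bf' : bmf f' by apply: bmf_clamp; case: bf.
exists (f' \o reindex g); rewrite -gba; apply: near_min_reindex => //; split.
- exact: (local_off_comp2 (op := fun x _ => Num.max 0 (Num.min 1 x)) bf' bf bf).
- by move=> w; rewrite /f' le_max lexx/= ge_max ler01 ge_min lexx.
- apply: le_trans (ltW fe); apply: le_mean => [||w].
  + exact: bmf_sqrB (bmf_xi b) bf'.
  + exact: bmf_sqrB (bmf_xi b) bf.1.
  + have /andP[x0 x1] := xi01 b w; rewrite /f'.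
    rewrite maxEle minEle; case: ifPn; case: ifPn; rewrite -?ltNge; nra.
Qed.

(** The midpoint of [f] and [f'] is again a competitor, so in the parallelogram identity the terms
    [4 * min_sqdist] cancel. *)
Lemma near_min_close a e e' f f' : near_min a e f -> near_min a e' f' ->
  sqdist mu f f' <= 2 * (e + e').
Proof.
move=> [af _ fe] [af' _ fe'].
rewrite (sqdist_parallelogram mu (bmf_xi a) af.1 af'.1).
have : min_sqdist <= sqdist mu (xi a) (fun x => 2^-1 * (f x + f' x)).
  apply: min_sqdist_le.
  apply: (local_off_comp2 (op := fun x y => 2^-1 * (x + y))) => //.
  by apply: bmfZ; apply: bmfD; [case: af|case: af'].
lra.
Qed.

(* The conditional expectations attached to [a] and [b] are equal. *)
Definition close a b := forall e, 0 < e -> exists f1 f2 : X -> R,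
  [/\ near_min a e f1, near_min b e f2 & sqdist mu f1 f2 <= e].

Lemma close_refl a : close a a.
Proof.
move=> e e0; have [f af] := near_min_ex a e0.
by exists f, f; rewrite sqdist_xx ltW.
Qed.

Lemma close_sym a b : close a b -> close b a.
Proof.
by move=> ab e /ab[f [h [af bh fh]]]; exists h, f; rewrite sqdistC.
Qed.

(** Two triangle inequalities: [2 * 4 + 2 * (2 * 1 + 2 * 4) = 28]. *)
Lemma close_near_min a b e f (h : X -> R) : 0 < e -> close a b ->
  near_min a e f -> near_min b e h -> sqdist mu f h <= 28 * e.
Proof.
move=> e0 ab af bh; have [f' [h' [af' bh' fh']]] := ab _ e0.
have bmf' := near_min_bmf; have ff' := near_min_close af af'.
have hh' := near_min_close bh' bh.
have := sqdist_triangle mu (bmf' _ _ _ af) (bmf' _ _ _ af') (bmf' _ _ _ bh).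
have := sqdist_triangle mu (bmf' _ _ _ af') (bmf' _ _ _ bh') (bmf' _ _ _ bh).
lra.
Qed.

Lemma close_trans a b c : close a b -> close b c -> close a c.
Proof.
(* The final bound is [2 * e' + 2 * 28 * e' = 58 * e'], where [e' = e / 60]. *)
move=> ab bc e e0; have e'0 : 0 < e / 60 by rewrite divr_gt0.
have [f [h [af bh fh]]] := ab _ e'0; have [k ck] := near_min_ex c e'0.
exists f, k; split; [apply: near_minW af; lra|apply: near_minW ck; lra|].
have hk := close_near_min e'0 bc bh ck.
have := sqdist_triangle mu
  (near_min_bmf af) (near_min_bmf bh) (near_min_bmf ck).
lra.
Qed.

Lemma close_reindex g a b : G g -> close a b -> close (g a) (g b).
Proof.
move=> Gg ab e /ab[f [h [af bh fh]]].
exists (f \o reindex g), (h \o reindex g); split.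
- exact: near_min_reindex.
- exact: near_min_reindex.
- by rewrite sqdist_reindex//; [case: af => -[] | case: bh => -[]].
Qed.

Lemma close_total a b : a <> b -> close a b -> forall c d, close c d.
Proof.
move=> ab cab; apply: (primitive_equivalence HG Gprim _ _ _ _ ab cab).
- exact: close_refl.
- exact: close_sym.
- exact: close_trans.
- by move=> g c d; exact: close_reindex.
Qed.

(** * Closeness of all coordinates under either condition *)

Lemma enum_off a : exists2 b : nat -> M, (forall n, b n <> a) &
  forall s, a \notin s -> exists n, forall c, c \in s -> c \in mkseq b n.
Proof.
have [g _ ga] := moved_off Gnoalg (isT : a \notin [::]).
(* Codes of [a] and codes of nothing receive the value [g a], which differs from [a]. *)
pose b n := if @choice.unpickle M n is Some c then
  if c == a then g a else c else g a.
exists b => [n|s as_].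
  by rewrite /b; case: choice.unpickle => // c; case: eqP.
exists (\max_(c <- s) choice.pickle c).+1 => c cs.
apply/mapP; exists (choice.pickle c).
  by rewrite mem_iota ltnS /=; exact: leq_bigmax_seq.
by rewrite /b choice.pickleK; case: eqP => // ca; rewrite -ca cs in as_.
Qed.

Lemma uniform_close : uniform_non_algebraicity G -> forall c d, close c d.
Proof.
move=> [_ una] c0; have [b ba bs] := enum_off c0.
(* The pair is fixed before [e], as closeness requires; this is why the whole infinite tuple is
   used. *)
have [b' [a' [a'' [a'a'' b'a' b'a'']]]] := una b c0 ba.
apply: (close_total a'a'') => e e0.
have [f cf] := near_min_ex c0 e0.
have [[_ [s as_ sf]] _ _] := cf; have [n sn] := bs _ as_.
have [g Gg] := b'a'' n; rewrite map_rcons => /rcons_inj[gb' ga''].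
have [h Gh] := b'a' n; rewrite map_rcons => /rcons_inj[hb' ha'].
pose f'' := f \o reindex g^-1%g.
have f''min : near_min a'' e f''.
  rewrite (_ : a'' = g^-1%g c0); last by rewrite -ga'' /= sym_funK.
  by apply: near_min_reindex => //; exact: subgroupV.
have hfix c : c \in map g^-1%g s -> h^-1%g c = c.
  move=> /mapP[x /sn + ->]; rewrite -gb' => /mapP[y yb' ->].
  have hy : h y = y by move/eq_in_map: (etrans hb' (esym (map_id _))); exact.
  by rewrite /= sym_funK -[in LHS]hy sym_funK.
have hf'' := depends_on_fixed hfix (depends_on_reindex sf).
(* One function serves both points: [h] fixes its support and sends [a'] to [a'']. *)
exists f'', f''; split=> //; last by rewrite sqdist_xx ltW.
have -> : a' = h^-1%g a'' by rewrite -ha' /= sym_funK.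
by rewrite -[f'']hf''; apply: near_min_reindex => //; exact: subgroupV.
Qed.

Lemma bounded_close a : boundedly_maximal G (stabilizer G a) ->
  forall c d, close c d.
Proof.
move=> [d dP].
have [g0 [Gg0 _] g0a] := moved_off Gnoalg (isT : a \notin [::]).
have ca h : G h -> close a (h a).
  (* Each letter multiplies the error by at most 4, starting from [4 * e']. The bound [d] must
     precede [g], since [g] depends on the support of [f] and thus on [e]. *)
  move=> Gh e e0; pose e' := e / 4 ^+ d.+1.
  have e'0 : 0 < e' by rewrite divr_gt0// exprn_gt0.
  have [f af] := near_min_ex a e'0; have bf := near_min_bmf af.
  have brf k : bmf (f \o reindex k).
    by apply: bmf_comp bf; exact: measurable_reindex.
  have [[_ [s as_ sf]] _ _] := af.
  have [g [Gg gs] ga] := moved_off Gnoalg as_.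
  have e'e : e' <= e.
    by rewrite ler_pdivrMr ?exprn_gt0// ler_peMr ?(ltW e0)// exprn_ege1// ler1n.
  pose Q n k := G k /\ sqdist mu f (f \o reindex k) <= 4 ^+ n * (4 * e').
  have Q0 : Q 0%N 1%g.
    split; first exact: subgroup1.
    rewrite (_ : f \o _ = f) ?sqdist_xx ?mulr_ge0 ?exprn_ge0//.
    exact: ltW.
  have QS n x k : [\/ x = g, x = g^-1%g | stabilizer G a x] -> Q n k ->
      Q n.+1 (x * k)%g.
    move=> xP [Gk fk].
    (* The letters [g] and [g^-1] fix [f]; an element of the stabilizer turns [f] into another near
       minimizer at [a]. *)
    have [Gx fx] : G x /\ sqdist mu f (f \o reindex x) <= 4 * e'.
      have fg (u : Sym M) : (forall c, c \in s -> u c = c) ->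
          sqdist mu f (f \o reindex u) <= 4 * e'.
        move=> us; rewrite (depends_on_fixed us sf) sqdist_xx.
        by rewrite mulr_ge0// ltW.
      case: xP => [->|->|[Gx xa]]; split=> //.
      + exact: fg.
      + exact: subgroupV.
      + by apply: fg => c cs; rewrite -[in LHS](gs _ cs) /= sym_funK.
      + have := near_min_reindex Gx af.
        rewrite xa => /(near_min_close af); lra.
    split; first exact: subgroupM.
    have := sqdist_triangle mu bf (brf x) (brf (x * k)%g).
    rewrite -[f \o reindex (x * k)%g]/((f \o reindex k) \o reindex x).
    rewrite (sqdist_reindex Gx bf (brf k)).
    have : 1 <= (4 : R) ^+ n by rewrite exprn_ege1// ler1n.
    rewrite exprS; nra.
  have ngx : (G `\` stabilizer G a) g by split=> // -[_]; exact: ga.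
  have [m md [_ mh]] := word_ind Q0 QS (dP g ngx _ Gh).
  exists f, (f \o reindex h); split.
  - exact: near_minW af.
  - by apply: near_min_reindex => //; exact: near_minW af.
  - apply: le_trans mh _; rewrite mulrA -exprSr /e' mulrC.
    rewrite mulrAC ler_pdivrMr ?exprn_gt0// ler_wpM2l ?(ltW e0)//.
    by rewrite ler_weXn2l ?ler1n.
apply: (@close_total a (g0 a)); last exact: ca.
by move=> /esym.
Qed.

(** * Approximate orthogonality and independence of one coordinate *)

Lemma near_min_orthogonal a (e : R) f th : 0 < e -> near_min a (e ^+ 2) f ->
  local_off a th ->
  2 * (I (fun w => xi a w * th w) - I (fun w => f w * th w)) <=
  e * (1 + I (fun w => th w ^+ 2)).
Proof.
move=> e0 [af _ fe] ath; have bx := bmf_xi a.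
(* First variation: [f + e * th] is still a competitor, and dividing the near minimality inequality
   by [e] leaves an error of order [e]. *)
have bft : bmf (fun w => f w + e * th w) by apply: bmfD af.1 (bmfZ _ ath.1).
have le : min_sqdist <= sqdist mu (xi a) (fun w => f w + e * th w).
  apply: min_sqdist_le.
  exact: (local_off_comp2 (op := fun x y => x + e * y) bft af ath).
have sqE : sqdist mu (xi a) (fun w => f w + e * th w) =
    sqdist mu (xi a) f -
    (2 * e * (I (fun w => xi a w * th w) - I (fun w => f w * th w)) -
     e ^+ 2 * I (fun w => th w ^+ 2)).
  have b1 := bmfM bx ath.1; have b2 := bmfM af.1 ath.1.
  have b3 := bmf_sqr ath.1; have b4 := bmfB b1 b2.
  have b5 := bmfZ (2 * e) b4; have b6 := bmfZ (e ^+ 2) b3.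
  rewrite -meanB// -!meanZ// -meanB// /sqdist -meanB//; first last.
  - exact: bmfB.
  - exact: bmf_sqrB bx af.1.
  by congr I; apply/funext => w; ring.
rewrite sqE in le.
rewrite -(ler_pM2l e0); nra.
Qed.

Lemma independence a th : (forall c d, close c d) -> local_off a th ->
  I (fun w => xi a w * th w) = I (xi a) * I th.
Proof.
move=> cl ath.
pose e n : R := 8^-1 ^+ n.
have e0 n : 0 < e n by rewrite exprn_gt0.
have e1 n : e n <= 1 by rewrite exprn_ile1//; lra.
have eS n : e n.+1 <= e n by rewrite /e exprS; have := e0 n; rewrite /e; lra.
have [eta etaP] := choice (fun n => near_min_ex a (exprn_gt0 2 (e0 n))).
have beta n : bmf (eta n) := near_min_bmf (etaP n).
(* The errors [e n ^+ 2] are at most [8^-1 ^+ n]; 28 comes from [close_near_min] and also covers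
   consecutive terms. *)
have [||||||p pP] := @ergodic_limit _ _ _ mu
    [set reindex g | g in G] eta 28.
- by move=> _ [g Gg <-]; exact: measurable_reindex.
- move=> E mE inv; apply: mu_erg => // g Gg.
  by rewrite cube_shift_image; apply: inv; exists g.
- by move=> n; case: (beta n).
- by move=> n w; case: (etaP n).
- move=> n; have := near_min_close (etaP n) (etaP n.+1).
  have := e0 n; have := e0 n.+1; have := e1 n; have := eS n.
  rewrite -/(e n) !expr2; nra.
- move=> _ n [g Gg <-].
  have := close_near_min (exprn_gt0 2 (e0 n)) (cl a (g a)) (etaP n)
    (near_min_reindex Gg (etaP n)).
  have := e0 n; have := e1 n; rewrite -/(e n) expr2; nra.
have lim t : local_off a t -> I (fun w => xi a w * t w) = p * I t.
  move=> at_; apply: (cvg_unique _ _ (pP t at_.1)) => //.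
  pose K := 2^-1 * (1 + I (fun w => t w ^+ 2)).
  have Ke : (K * e n) @[n --> \oo] --> 0.
    by apply: cvg_geometric; rewrite ger0_norm; lra.
  have bxt := bmfM (bmf_xi a) at_.1.
  (* Orthogonality is one-sided; testing against [-1 * t] gives the opposite inequality. *)
  have aNt : local_off a (fun w => -1 * t w).
    exact: (local_off_comp2 (op := fun x _ => -1 * x) (bmfZ _ at_.1) at_ at_).
  apply: (@squeeze_cvgr _ _ _ _
    (fun n => I (fun w => xi a w * t w) - K * e n)
    (fun n => I (fun w => xi a w * t w) + K * e n)).
  - apply: nearW => n.
    have := near_min_orthogonal (e0 n) (etaP n) at_.
    have := near_min_orthogonal (e0 n) (etaP n) aNt.
    have mulN1E u : bmf u ->
        I (fun w => u w * (-1 * t w)) = -1 * I (fun w => u w * t w).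
      move=> bu; rewrite -meanZ; last exact: bmfM bu at_.1.
      by congr I; apply/funext => w; ring.
    rewrite (mulN1E _ (bmf_xi a)) (mulN1E _ (beta n)).
    rewrite (_ : (fun w => (-1 * t w) ^+ 2) = (fun w => t w ^+ 2)); last first.
      by apply/funext => w; ring.
    rewrite /K; lra.
  - by rewrite -[X in _ --> X]subr0; apply: cvgB => //; exact: cvg_cst.
  - by rewrite -[X in _ --> X]addr0; apply: cvgD => //; exact: cvg_cst.
(* The test function 1 identifies [p]. *)
have pE : I (xi a) = p.
  rewrite -[p]mulr1 -(mean_cst mu 1) -lim; last exact: local_off_cst.
  by congr I; apply/funext => w; rewrite mulr1.
by rewrite lim// pE.
Qed.

End Cube.

HB.instance Definition _ (R : realType) (M : countType) (a : M) :=
  isMeasurableFun.Build _ _ _ _ (@coord R M a) (@measurable_coord R M a).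

Lemma Rintegral_indicE d (T : measurableType d) (R : realType)
    (mu : probability T R) (E : set T) :
  measurable E -> (Rintegral mu setT \1_E)%:E%E = mu E.
Proof.
by move=> mE; rewrite /Rintegral integral_indic// setIT fineK// fin_num_measure.
Qed.

(** * From independence of each coordinate to a product measure *)

Section ProductMeasure.
Variables (R : realType) (M : countType).
Variable mu : probability (borel (cube R M)) R.
Local Open Scope ring_scope.
Local Notation X := (borel (cube R M)).
Local Notation I := (Rintegral mu setT).

Definition cylinder (s : seq M) (B : M -> set (borel (unit_interval R))) :
  set X := [set w | forall a, a \in s -> B a (w a)].

Lemma cylinder_nil B : cylinder [::] B = setT.
Proof. by apply/seteqP; split=> w. Qed.

Lemma cylinder_cons a s B :
  cylinder (a :: s) B = coord a @^-1` B a `&` cylinder s B.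
Proof.
apply/seteqP; split=> [w Bw|w [Ba Bs] c].
  by split=> [|c cs]; apply: Bw; rewrite in_cons ?eqxx ?cs ?orbT.
by rewrite in_cons => /predU1P[->//|]; exact: Bs.
Qed.

Lemma measurable_cylinder s B :
  (forall a, measurable (B a)) -> measurable (cylinder s B).
Proof.
move=> mB; elim: s => [|a s IH]; first by rewrite cylinder_nil.
rewrite cylinder_cons; apply: measurableI => //.
by rewrite -[X in measurable X]setTI; exact: measurable_coord.
Qed.

(** Induction splits off one coordinate at a time: as [a] is not in [s], the indicator of the
    cylinder over [s] is local off [a]. The factors are the marginals. *)
Lemma independent_product :
  (forall B, measurable B -> forall a th, local_off a th ->
    I (fun w => xi B a w * th w) = I (xi B a) * I th) ->
  product_measure mu.
Proof.
move=> ind; exists (fun a => distribution mu (@coord R M a)) => A B mB.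
change (mu (cylinder A B) =
  (\prod_(a <- A) distribution mu (@coord R M a) (B a))%E).
elim: (A : seq M) (finmap.fset_uniq A) => [_|a s IH /= /andP[as_ us]].
  by rewrite cylinder_nil big_nil; exact: probability_setT.
have mBa : measurable (@coord R M a @^-1` B a).
  by rewrite -[X in measurable X]setTI; exact: measurable_coord.
have ms := measurable_cylinder s mB.
have sth : local_off a (\1_(cylinder s B) : X -> R).
  split; last first.
    exists s => // w w' ww'; rewrite !indicE; congr (_ %:R).
    congr (nat_of_bool _); apply/idP/idP => /set_mem ws; apply/mem_set => c cs.
      by rewrite -ww'//; exact: ws.
    by rewrite ww'//; exact: ws.
  apply: bmf_unit_interval; first exact: measurable_indic.
  by move=> w; rewrite indicE; case: (_ \in _); rewrite ?lexx ?ler01.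
rewrite big_cons -IH// -[RHS]/(mu (@coord R M a @^-1` B a) * _)%E.
rewrite cylinder_cons -!Rintegral_indicE//; last exact: measurableI.
by rewrite -EFinM -(ind _ (mB a) a _ sth) indicI.
Qed.

End ProductMeasure.

Theorem theorem1p2 (R : realType) (M : countType) (G : set (Sym M))
    (HG : subgroup G) (Hprim : primitive G) (Hnoalg : no_algebraicity G) :
  (roelcke_precompact G ->
     uniform_non_algebraicity G /\
     forall a : M, boundedly_maximal G (stabilizer G a)) /\
  (uniform_non_algebraicity G \/
     (forall a : M, boundedly_maximal G (stabilizer G a)) ->
   forall mu : probability (borel (cube R M)) R,
     invariant_measure G mu -> ergodic G mu -> product_measure mu).
Proof.
split=> [Grp|Gcond mu mu_inv mu_erg].
  split; first exact: roelcke_uniform_non_algebraicity.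
  by move=> a; exact: roelcke_boundedly_maximal.
apply: independent_product => B mB a th ath.
apply: (independence Hprim mu_inv mu_erg mB) => //.
case: Gcond => [Guna|/(_ a) Gbm].
- exact: (uniform_close HG Hprim Hnoalg mu_inv mB Guna).
- exact: (bounded_close HG Hprim Hnoalg mu_inv mB Gbm).
Qed.
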